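(* Let $M_1$ and $M_2$ be two $\Gamma$-semigroups, let $T: M_1 \to \mathcal{P}^*(M_2)$ be a set-valued anti-homomorphism, and let $J$ be an interior ideal of $M_2$. Then: (i) $\overline{T}(J)$ is an interior ideal of $M_1$, if $\overline{T}(J)\neq\emptyset$; (ii) $\underline{T}(J)$ is an interior ideal of $M_1$, if $\underline{T}(J)\neq\emptyset$ and $T$ is a strong set-valued anti-homomorphism.
   Context: For non-empty sets $M$ and $\Gamma$, $M$ is a $\Gamma$-semigroup if there is a map $M\times\Gamma\times M\to M$, $(a,\alpha,b)\mapsto a\alpha b$, with $(a\alpha b)\beta c = a\alpha(b\beta c)$ for all $a,b,c\in M$, $\alpha,\beta\in\Gamma$. Both $M_1$ and $M_2$ are $\Gamma$-semigroups for the same set $\Gamma$. For subsets $A,B$ of a $\Gamma$-semigroup and $\alpha\in\Gamma$, $A\alpha B=\{a\alpha b : a\in A, b\in B\}$ and $A\Gamma B=\{a\gamma b : a\in A, b\in B,\gamma\in\Gamma\}$. $\mathcal{P}^*(M_2)$ is the set of all non-empty subsets of $M_2$. A map $T:M_1\to\mathcal{P}^*(M_2)$ is a set-valued anti-homomorphism if $T(a\alpha b)\supseteq T(b)\alpha T(a)$ for all $a,b\in M_1$, $\alpha\in\Gamma$; it is a strong set-valued anti-homomorphism if $T(a\alpha b)=T(b)\alpha T(a)$ for all $a,b\in M_1$, $\alpha\in\Gamma$. For $G\subseteq M_2$, $\underline{T}(G)=\{x\in M_1 : T(x)\subseteq G\}$ and $\overline{T}(G)=\{x\in M_1 : T(x)\cap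 G\neq\emptyset\}$. A non-empty subset $S$ of a $\Gamma$-semigroup $M$ is a sub-$\Gamma$-semigroup of $M$ if $S\Gamma S\subseteq S$. A non-empty subset $J$ of $M$ is an interior ideal of $M$ if $J$ is a sub-$\Gamma$-semigroup of $M$ and $M\Gamma J\Gamma M\subseteq J$. *)

(* Defs.v *)
From mathcomp Require Import all_boot.
From mathcomp Require Import boolp classical_sets.

Set Implicit Arguments.
Unset Strict Implicit.
Unset Printing Implicit Defensive.

Local Open Scope classical_set_scope.

Record gammaSemigroup (Gamma : Type) := GammaSemigroup {
  gs_sort :> Type;
  gop : gs_sort -> Gamma -> gs_sort -> gs_sort;
  gs_nonempty : [set: gs_sort] !=set0;
  gs_index_nonempty : [set: Gamma] !=set0;
  gopA : forall (a b c : gs_sort) (alpha beta : Gamma),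
    gop (gop a alpha b) beta c = gop a alpha (gop b beta c)
}.

Record nonemptySet (X : Type) := NonemptySet {
  nonemptySet_val :> set X;
  nonemptySetP : nonemptySet_val !=set0
}.

Section GammaSemigroupSets.
Variables (Gamma : Type) (M : gammaSemigroup Gamma).
Implicit Types (A B S J : set M) (alpha : Gamma).

Definition setgop A alpha B : set M :=
  [set gop a alpha b | a in A & b in B].

Definition setGop A B : set M := \bigcup_(gamma in [set: Gamma]) setgop A gamma B.

Definition sub_gamma_semigroup S : Prop := S !=set0 /\ setGop S S `<=` S.

Definition interior_ideal J : Prop :=
  [/\ J !=set0,
      sub_gamma_semigroup J
    & setGop (setGop [set: M] J) [set: M] `<=` J].

End GammaSemigroupSets.

Section SetValued.
Variables (Gamma : Type) (M1 M2 : gammaSemigroup Gamma).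
Implicit Types (T : M1 -> nonemptySet M2) (G : set M2).

Definition set_valued_antihom T : Prop :=
  forall (a b : M1) (alpha : Gamma),
    setgop (T b) alpha (T a) `<=` T (gop a alpha b).

Definition strong_set_valued_antihom T : Prop :=
  forall (a b : M1) (alpha : Gamma),
    T (gop a alpha b) = setgop (T b) alpha (T a) :> set M2.

Definition lower_approx T G : set M1 := [set x | T x `<=` G].

Definition upper_approx T G : set M1 := [set x | T x `&` G !=set0].

End SetValued.

(* Main.v *)
Require Import Defs.
From mathcomp Require Import all_boot.
From mathcomp Require Import boolp classical_sets.

Local Open Scope classical_set_scope.

Lemma mem_setGop (Gamma : Type) (M : gammaSemigroup Gamma) (A B : set M)
    (a b : M) (g : Gamma) :
  A a -> B b -> setGop A B (gop a g b).
Proof. by move=> Aa Bb; exists g => //; exists a => //; exists b. Qed.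

Lemma setGop_subset (Gamma : Type) (M : gammaSemigroup Gamma) (A B C : set M) :
  (forall a g b, A a -> B b -> C (gop a g b)) -> setGop A B `<=` C.
Proof. by move=> H _ [g _ [a Aa [b Bb <-]]]; exact: H. Qed.

(** Trades inclusions of set products for closure conditions on elements, the form in which both
    approximations are checked below. *)
Lemma interior_idealP (Gamma : Type) (M : gammaSemigroup Gamma) (J : set M) :
  interior_ideal J <->
  [/\ J !=set0,
      forall x g y, J x -> J y -> J (gop x g y)
    & forall a g x h b, J x -> J (gop (gop a g x) h b)].
Proof.
split=> [[J0 [_ JJ] MJM]|[J0 JJ MJM]].
  split=> // [x g y Jx Jy|a g x h b Jx]; first exact/JJ/mem_setGop.
  by apply/MJM/mem_setGop => //; exact: mem_setGop.
split=> //; first by split=> //; exact: setGop_subset.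
by apply: setGop_subset => _ h b [g _ [a _ [x Jx <-]]] _; exact: MJM.
Qed.

(* An antihomomorphism sends [(a g x) h b] to [T b h (T x g T a)], which
   associativity turns into [(T b h T x) g T a]: the factor from [T x] stays in
   the middle, so the ideal condition on [J] applies. *)
Theorem theorem5p5 (Gamma : Type) (M1 M2 : gammaSemigroup Gamma)
    (T : M1 -> nonemptySet M2) (J : set M2)
    (hT : set_valued_antihom T) (hJ : interior_ideal J) :
  (upper_approx T J !=set0 -> interior_ideal (upper_approx T J)) /\
  (lower_approx T J !=set0 -> strong_set_valued_antihom T ->
     interior_ideal (lower_approx T J)).
Proof.
move/interior_idealP: hJ => [_ JJ MJM].
have Tgop a g b u v :
  (T a : set M2) u -> (T b : set M2) v ->
  (T (gop a g b) : set M2) (gop v g u).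
  by move=> Tu Tv; apply: hT; exists v => //; exists u.
split=> [U0|L0 sT]; apply/interior_idealP; split=> //.
- move=> x g y [u [Tu Ju]] [v [Tv Jv]].
  by exists (gop v g u); split; [exact: Tgop | exact: JJ].
- move=> a g x h b [u [Tu Ju]].
  (* Nothing is known of [a] and [b], but values of [T] are non-empty, so [u] can be completed by
     some outer factors [p] and [q]. *)
  have [[p Tp] [q Tq]] := (nonemptySetP (T a), nonemptySetP (T b)).
  exists (gop q h (gop u g p)); split; last by rewrite -gopA; exact: MJM.
  by apply/Tgop => //; exact/Tgop.
(* All of [T (gop x g y)] must lie in [J]: the equality [sT] factors each of its elements, while the
   inclusion [hT] only produces some of them. *)
- move=> x g y Lx Ly; rewrite /lower_approx /= sT => _ [v Tv [u Tu <-]].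
  by apply: JJ; [exact: Ly | exact: Lx].
- move=> a g x h b Lx; rewrite /lower_approx /= !sT.
  move=> _ [q _ [_ [u Tu [p _ <-]] <-]].
  by rewrite -gopA; apply/MJM/Lx.
Qed.
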